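(* Let $\mathrm{k}$ be a commutative $\mathbb{Q}$-algebra, let $\lambda\in\mathrm{k}$, let $A$ be a $\mathrm{k}$-algebra, and let $\ell\in\mathbb{N}\cup\{\infty\}$. Each Rota--Baxter operator $P$ of weight $\lambda$ on $A$ lifts to a Rota--Baxter operator $\bar P$ of weight $\lambda$ on $(A^\ell,\cdot^\lambda)$, and to a Rota--Baxter operator $\tilde P$ of weight $\lambda$ on $(A^\ell,\text{pointwise})$, defined by $$\bar P(a)_n=\begin{cases}P(a_0)&\text{for }n=0;\\ a_{n-1}&\text{for }n>0,\end{cases}\qquad\qquad \tilde P(a)_n=P(a_0)+\lambda\sum_{i<n}a_i .$$ Moreover, the $\mathrm{k}$-algebra morphism $\gamma_\ell\colon(A^\ell,\cdot^\lambda)\to(A^\ell,\text{pointwise})$ given by $\gamma_\ell(a)_n=\sum_m\binom{n}{m}\lambda^m a_m$ is a map of Rota--Baxter algebras, in the sense that $\gamma_\ell\bar P=\tilde P\gamma_\ell$.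
   Context: Algebras are associative and unital, not necessarily commutative. A Rota--Baxter operator of weight $\lambda$ on a $\mathrm{k}$-algebra $B$ is a $\mathrm{k}$-linear map $P\colon B\to B$ with $P(a)P(b)=P(P(a)b+aP(b)+\lambda ab)$ for all $a,b\in B$. For $\ell\in\mathbb{N}\cup\{\infty\}$, $A^\ell$ is the $\mathrm{k}$-module of sequences $(a_n)_{0\le n<\ell}$ in $A$ (so $A^\infty=A^{\mathbb{N}}$). The $\lambda$-weighted Hurwitz product on $A^\ell$ is, for $0\le n<\ell$, $$(a\cdot^\lambda b)_n=\sum_{r+s+t=n}\binom{n}{r,s,t}\lambda^t a_{r+t}b_{s+t},\qquad \binom{n}{r,s,t}=\frac{n!}{r!\,s!\,t!},$$ with unit $(1,0,0,\dots)$. $(A^\ell,\text{pointwise})$ is $A^\ell$ with componentwise multiplication and unit $(1,1,1,\dots)$. In the formulas for $\bar P$, $\tilde P$ and $\gamma_\ell$, the index $n$ ranges over $0\le n<\ell$. *)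

(* Defs.v *)
From HB Require Import structures.
From mathcomp Require Import all_boot all_algebra.
From mathcomp Require Import boolp functions.
From mathcomp Require Import zify.

Set Implicit Arguments.
Unset Strict Implicit.
Unset Printing Implicit Defensive.

Import GRing.Theory.
Local Open Scope ring_scope.

(* The algType of ssralg excludes the zero ring, whereas the algebras used here
   are associative and unital but possibly zero: for l = 0 the algebra A^l is
   zero, whatever A is.  A structure cannot join PzRing and Lmodule below the
   existing LSemiAlgebra, so the scaling is a field of the mixin,
   and every pzAlgType is then equipped with the lmodType structure it
   induces, so that _ *: _ and linear keep their usual meaning. *)
HB.mixin Record isPzAlgebra (R : pzRingType) A of GRing.PzRing A := {
  pzscale : R -> A -> A;
  pzscalerA : forall a b v, pzscale a (pzscale b v) = pzscale (a * b) v;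
  pzscale1r : left_id 1 pzscale;
  pzscalerDr : right_distributive pzscale +%R;
  pzscalerDl : forall v, {morph pzscale^~ v : a b / a + b};
  pzscalerAl : forall (c : R) (x y : A), pzscale c (x * y) = pzscale c x * y;
  pzscalerAr : forall (c : R) (x y : A), pzscale c (x * y) = x * pzscale c y
}.

#[short(type="pzAlgType")]
HB.structure Definition PzAlgebra (R : pzRingType) :=
  {A of GRing.PzRing A & isPzAlgebra R A}.

#[short(type="comPzAlgType")]
HB.structure Definition ComPzAlgebra (R : pzRingType) :=
  {A of GRing.ComPzRing A & PzAlgebra R A}.

HB.instance Definition _ (R : pzRingType) (A : algType R) :=
  isPzAlgebra.Build R (GRing.Algebra.sort A)
    (@scalerA R A) (@scale1r R A) (@scalerDr R A)
    (fun v a b => @scalerDl R A v a b) (@scalerAl R A) (@scalerAr R A).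

HB.instance Definition _ (R : pzRingType) (A : pzAlgType R) :=
  GRing.Zmodule_isLmodule.Build R (PzAlgebra.sort A)
    (@pzscalerA R A) (@pzscale1r R A) (@pzscalerDr R A) (@pzscalerDl R A).

Definition algebra_morphism (k : pzRingType) (A B : pzAlgType k)
  (f : A -> B) : Prop := linear f /\ monoid_morphism f.

Definition rota_baxter (k : pzRingType) (B : pzAlgType k) (lambda : k)
    (P : B -> B) : Prop :=
  linear P /\
  forall a b, P a * P b = P (P a * b + a * P b + lambda *: (a * b)).

Section Pointwise.
Variables (T : Type) (k : pzRingType) (A : pzAlgType k).

Let fct_scalerAl (c : k) (f g : T -> A) : c *: (f * g) = (c *: f) * g.
Proof. by apply/funext => i; exact: pzscalerAl. Qed.

Let fct_scalerAr (c : k) (f g : T -> A) : c *: (f * g) = f * (c *: g).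
Proof. by apply/funext => i; exact: pzscalerAr. Qed.

HB.instance Definition _ :=
  isPzAlgebra.Build k (T -> A) (@scalerA k (T -> A)) (@scale1r k (T -> A))
   (@scalerDr k (T -> A)) (fun v a b => @scalerDl k (T -> A) v a b)
   fct_scalerAl fct_scalerAr.

End Pointwise.
(* An element l of {0, 1, ...} U {oo} is encoded in option nat, None being oo,
   and A^l is the function type idx l -> A; its ring structure as a function
   type is the pointwise one. *)
Definition below (l : option nat) (n : nat) : bool :=
  if l is Some m then (n < m)%N else true.

Definition idx (l : option nat) : Type := {n : nat | below l n}.

Section Sequences.
Variables (A : nmodType) (l : option nat).

(* Extension by 0 and restriction make it possible to write formulas with plain
   natural indices; the values at indices n >= l never matter below. *)
Definition coef (a : idx l -> A) (n : nat) : A :=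
  if insub n is Some i then a i else 0.

Definition trunc (f : nat -> A) : idx l -> A := fun i => f (val i).

Lemma coef_below (a : idx l -> A) (i : idx l) : coef a (val i) = a i.
Proof. by rewrite /coef valK. Qed.

Lemma coef_trunc (f : nat -> A) n : below l n -> coef (trunc f) n = f n.
Proof. by move=> ln; rewrite /coef insubT. Qed.

Lemma below_le m n : (m <= n)%N -> below l n -> below l m.
Proof. by case: l => //= p; exact: leq_ltn_trans. Qed.

End Sequences.

Definition trinomial (r s t : nat) : nat :=
  ((r + s + t)`! %/ (r`! * s`! * t`!))%N.

Lemma trinomialE r s t :
  trinomial r s t = ('C(r + s + t, t) * 'C(r + s, s))%N.
Proof.
rewrite /trinomial -(@bin_fact (r + s + t) t) ?leq_addl// addnK.
rewrite -(@bin_fact (r + s) s) ?leq_addl// addnK.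
set x := 'C(_, _); set y := 'C(_, _).
have -> : (x * (t`! * (y * (s`! * r`!))) = x * y * (r`! * s`! * t`!))%N by nia.
by rewrite mulnK// !muln_gt0 !fact_gt0.
Qed.

Lemma trinomialS r s t : (0 < r + s + t)%N ->
  trinomial r s t = ((0 < r) * trinomial r.-1 s t
    + (0 < s) * trinomial r s.-1 t + (0 < t) * trinomial r s t.-1)%N.
Proof.
rewrite !trinomialE; case: r s t => [|r] [|s] [|t] //= _;
  rewrite ?(addn0, add0n, addnS, addSn, mul0n, mul1n, muln1, bin0, binn) //.
all: rewrite ?(binS, bin0, binn) //; nia.
Qed.

Section HurwitzProduct.
Variables (k : comPzRingType) (A : pzAlgType k) (lambda : k).
Implicit Types f g h : nat -> A.

Definition hmul f g (n : nat) : A :=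
  \sum_(r < n.+1) \sum_(s < n.+1) \sum_(t < n.+1 | (r + s + t == n)%N)
    (lambda ^+ t *: (f (r + t)%N * g (s + t)%N)) *+ trinomial r s t.

Let Tsum a b c n (F : nat -> nat -> nat -> A) : A :=
  \sum_(r < a) \sum_(s < b) \sum_(t < c)
    (if (r + s + t == n)%N then F r s t *+ trinomial r s t else 0).

Let TsumSa a b c n F : (n < a)%N -> Tsum a.+1 b c n F = Tsum a b c n F.
Proof.
move=> na; rewrite /Tsum big_ord_recr /= [X in _ + X]big1 ?addr0// => s _.
by apply: big1 => t _; case: eqP => //; lia.
Qed.

Let TsumSb a b c n F : (n < b)%N -> Tsum a b.+1 c n F = Tsum a b c n F.
Proof.
move=> nb; apply: eq_bigr => r _.
rewrite big_ord_recr /= [X in _ + X]big1 ?addr0// => t _.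
by case: eqP => //; lia.
Qed.

Let TsumSc a b c n F : (n < c)%N -> Tsum a b c.+1 n F = Tsum a b c n F.
Proof.
move=> nc; apply: eq_bigr => r _; apply: eq_bigr => s _.
by rewrite big_ord_recr /=; case: eqP => [|_]; rewrite ?addr0//; lia.
Qed.

Let hmulE f g n : hmul f g n = Tsum n.+1 n.+1 n.+1 n
  (fun r s t => lambda ^+ t *: (f (r + t)%N * g (s + t)%N)).
Proof.
by apply: eq_bigr => r _; apply: eq_bigr => s _; rewrite big_mkcond.
Qed.

Let TsumD N n F : Tsum N.+1 N.+1 N.+1 n.+1 F =
  Tsum N N.+1 N.+1 n (fun r s t => F r.+1 s t)
  + Tsum N.+1 N N.+1 n (fun r s t => F r s.+1 t)
  + Tsum N.+1 N.+1 N n (fun r s t => F r s t.+1).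
Proof.
pose G1 r s t := if (r + s + t == n.+1)%N
  then F r s t *+ ((0 < r) * trinomial r.-1 s t)%N else 0.
pose G2 r s t := if (r + s + t == n.+1)%N
  then F r s t *+ ((0 < s) * trinomial r s.-1 t)%N else 0.
pose G3 r s t := if (r + s + t == n.+1)%N
  then F r s t *+ ((0 < t) * trinomial r s t.-1)%N else 0.
transitivity (\sum_(r < N.+1) \sum_(s < N.+1) \sum_(t < N.+1) G1 r s t
  + \sum_(r < N.+1) \sum_(s < N.+1) \sum_(t < N.+1) G2 r s t
  + \sum_(r < N.+1) \sum_(s < N.+1) \sum_(t < N.+1) G3 r s t).
  rewrite -!big_split; apply: eq_bigr => r _ /=.
  rewrite -!big_split; apply: eq_bigr => s _ /=.
  rewrite -!big_split; apply: eq_bigr => t _ /=.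
  rewrite /G1 /G2 /G3; case: eqP => [rst|_]; last by rewrite !addr0.
  by rewrite trinomialS ?rst// !mulrnDr.
congr (_ + _ + _).
- rewrite big_ord_recl big1 ?add0r => [|s _]; last first.
    by apply: big1 => t _; rewrite /G1 /= mul0n mulr0n if_same.
  apply: eq_bigr => r _; apply: eq_bigr => s _; apply: eq_bigr => t _.
  by rewrite /G1 /= /bump !add1n !addSn eqSS mul1n.
- apply: eq_bigr => r _; rewrite big_ord_recl big1 ?add0r => [|t _]; last first.
    by rewrite /G2 /= mul0n mulr0n if_same.
  apply: eq_bigr => s _; apply: eq_bigr => t _.
  by rewrite /G2 /= /bump !add1n addnS addSn eqSS mul1n.
- apply: eq_bigr => r _; apply: eq_bigr => s _; rewrite big_ord_recl.
  rewrite {1}/G3 /= mul0n mulr0n if_same add0r; apply: eq_bigr => t _.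
  by rewrite /G3 /= /bump !add1n addnS eqSS mul1n.
Qed.

Lemma hmul0n f g : hmul f g 0 = f 0%N * g 0%N.
Proof.
rewrite hmulE /Tsum !big_ord1 /= expr0 /trinomial /= divn1 mulr1n.
exact: scale1r.
Qed.

Lemma hmulS f g n : hmul f g n.+1 =
  hmul (fun i => f i.+1) g n + hmul f (fun i => g i.+1) n
  + lambda *: hmul (fun i => f i.+1) (fun i => g i.+1) n.
Proof.
rewrite !hmulE TsumD.
do !rewrite (@TsumSa n.+1, @TsumSb _ n.+1, @TsumSc _ _ n.+1)//.
congr (_ + _ + _); rewrite /Tsum scaler_sumr; apply: eq_bigr => r _.
rewrite scaler_sumr; apply: eq_bigr => s _.
rewrite scaler_sumr; apply: eq_bigr => t _.
by case: eqP => _; rewrite ?scaler0// !scalerMnr scalerA -exprS !addnS.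
Qed.

Lemma hmul_eq f g f' g' n : (forall i, (i <= n)%N -> f i = f' i) ->
  (forall i, (i <= n)%N -> g i = g' i) -> hmul f g n = hmul f' g' n.
Proof.
move=> ff' gg'; apply: eq_bigr => r _; apply: eq_bigr => s _.
by apply: eq_bigr => t /eqP rst; rewrite ff' ?gg'; try lia.
Qed.

Lemma hmulDl f f' g n :
  hmul (fun i => f i + f' i) g n = hmul f g n + hmul f' g n.
Proof.
rewrite -!big_split; apply: eq_bigr => r _ /=.
rewrite -!big_split; apply: eq_bigr => s _ /=.
rewrite -!big_split; apply: eq_bigr => t _ /=.
by rewrite mulrDl scalerDr mulrnDl.
Qed.

Lemma hmulDr f g g' n :
  hmul f (fun i => g i + g' i) n = hmul f g n + hmul f g' n.
Proof.
rewrite -!big_split; apply: eq_bigr => r _ /=.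
rewrite -!big_split; apply: eq_bigr => s _ /=.
rewrite -!big_split; apply: eq_bigr => t _ /=.
by rewrite mulrDr scalerDr mulrnDl.
Qed.

Lemma hmulZl c f g n : hmul (fun i => c *: f i) g n = c *: hmul f g n.
Proof.
rewrite scaler_sumr; apply: eq_bigr => r _.
rewrite scaler_sumr; apply: eq_bigr => s _.
rewrite scaler_sumr; apply: eq_bigr => t _.
have -> : (c *: f (r + t)%N) * g (s + t)%N = c *: (f (r + t)%N * g (s + t)%N).
  exact/esym/pzscalerAl.
by rewrite !scalerMnr !scalerA mulrC.
Qed.

Lemma hmulZr c f g n : hmul f (fun i => c *: g i) n = c *: hmul f g n.
Proof.
rewrite scaler_sumr; apply: eq_bigr => r _.
rewrite scaler_sumr; apply: eq_bigr => s _.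
rewrite scaler_sumr; apply: eq_bigr => t _.
have -> : f (r + t)%N * (c *: g (s + t)%N) = c *: (f (r + t)%N * g (s + t)%N).
  exact/esym/pzscalerAr.
by rewrite !scalerMnr !scalerA mulrC.
Qed.

Lemma hmulA f g h n : hmul f (hmul g h) n = hmul (hmul f g) h n.
Proof.
elim: n f g h => [|n IH] f g h; first by rewrite !hmul0n mulrA.
rewrite !hmulS.
have dE u v : (fun i => hmul u v i.+1) =
    (fun i => hmul (fun i => u i.+1) v i + hmul u (fun i => v i.+1) i
    + lambda *: hmul (fun i => u i.+1) (fun i => v i.+1) i).
  by apply/funext => i; exact: hmulS.
rewrite !dE !(hmulDl, hmulDr, hmulZl, hmulZr) !IH !scalerDr.
by rewrite [LHS](AC (1*3*3) ((1*2*5)*3*(6*4*7))).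
Qed.

Definition hone (n : nat) : A := (n == 0%N)%:R.

Lemma hmul0l g n : hmul (fun=> 0) g n = 0.
Proof.
apply: big1 => r _; apply: big1 => s _; apply: big1 => t _.
by rewrite mul0r scaler0 mul0rn.
Qed.

Lemma hmul0r f n : hmul f (fun=> 0) n = 0.
Proof.
apply: big1 => r _; apply: big1 => s _; apply: big1 => t _.
by rewrite mulr0 scaler0 mul0rn.
Qed.

Lemma hmul1l g n : hmul hone g n = g n.
Proof.
elim: n g => [|n IH] g; first by rewrite hmul0n mul1r.
by rewrite hmulS !hmul0l IH scaler0 addr0 add0r.
Qed.

Lemma hmul1r f n : hmul f hone n = f n.
Proof.
elim: n f => [|n IH] f; first by rewrite hmul0n mulr1.
by rewrite hmulS !hmul0r IH scaler0 !addr0.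
Qed.

End HurwitzProduct.

(* lambda is a phantom parameter, so that instance resolution finds the
   lambda-weighted product on this type and the pointwise one on idx l -> A. *)
Definition hurwitz (k : comPzRingType) (A : pzAlgType k) (lambda : k)
  (l : option nat) : Type := idx l -> A.

Section Hurwitz.
Variables (k : comPzRingType) (A : pzAlgType k) (lambda : k) (l : option nat).

Local Notation hurwitz := (hurwitz A lambda l).

HB.instance Definition _ := GRing.Zmodule.copy hurwitz (idx l -> A).

Implicit Types a b : hurwitz.

Definition hurwitz_one : hurwitz := trunc (hone A).

Definition hurwitz_mul a b : hurwitz :=
  trunc (hmul lambda (coef a) (coef b)).

Let hurwitz_mulA : associative hurwitz_mul.
Proof.
move=> a b c; apply/funext => i; rewrite /hurwitz_mul {1 3}/trunc.
transitivity (hmul lambda (coef a) (hmul lambda (coef b) (coef c)) (val i)).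
  apply: hmul_eq => // j ji; apply: coef_trunc.
  exact: below_le ji (valP i).
rewrite hmulA; apply/esym/hmul_eq => // j ji; apply: coef_trunc.
exact: below_le ji (valP i).
Qed.

Let hurwitz_mul1l : left_id hurwitz_one hurwitz_mul.
Proof.
move=> a; apply/funext => i; rewrite -[RHS]coef_below -[RHS](hmul1l lambda).
apply: hmul_eq => // j ji; apply: coef_trunc; exact: below_le ji (valP i).
Qed.

Let hurwitz_mul1r : right_id hurwitz_one hurwitz_mul.
Proof.
move=> a; apply/funext => i; rewrite -[RHS]coef_below -[RHS](hmul1r lambda).
apply: hmul_eq => // j ji; apply: coef_trunc; exact: below_le ji (valP i).
Qed.

Let coefD (a b : idx l -> A) n : coef (a + b) n = coef a n + coef b n.
Proof. by rewrite /coef; case: insubP => // _; rewrite addr0. Qed.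

Let coefZ (c : k) (a : idx l -> A) n : coef (c *: a) n = c *: coef a n.
Proof. by rewrite /coef; case: insubP => // _; rewrite scaler0. Qed.

Let hurwitz_mulDl : left_distributive hurwitz_mul +%R.
Proof.
move=> a b c; apply/funext => i; rewrite /hurwitz_mul /trunc.
by rewrite (funext (coefD a b)) hmulDl.
Qed.

Let hurwitz_mulDr : right_distributive hurwitz_mul +%R.
Proof.
move=> a b c; apply/funext => i; rewrite /hurwitz_mul /trunc.
by rewrite (funext (coefD b c)) hmulDr.
Qed.

HB.instance Definition _ := GRing.Zmodule_isPzRing.Build hurwitz
  hurwitz_mulA hurwitz_mul1l hurwitz_mul1r hurwitz_mulDl hurwitz_mulDr.

Let hurwitz_scale (c : k) (a : hurwitz) : hurwitz := c *: (a : idx l -> A).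

Let hurwitz_scalerAl c a b :
  hurwitz_scale c (a * b) = hurwitz_scale c a * b.
Proof.
apply/funext => i; apply/esym; rewrite /GRing.mul /= /hurwitz_mul /trunc.
by rewrite (funext (coefZ c a)) hmulZl.
Qed.

Let hurwitz_scalerAr c a b :
  hurwitz_scale c (a * b) = a * hurwitz_scale c b.
Proof.
apply/funext => i; apply/esym; rewrite /GRing.mul /= /hurwitz_mul /trunc.
by rewrite (funext (coefZ c b)) hmulZr.
Qed.

HB.instance Definition _ := isPzAlgebra.Build k hurwitz
  (@scalerA k (idx l -> A)) (@scale1r k (idx l -> A))
  (@scalerDr k (idx l -> A)) (fun v c e => @scalerDl k (idx l -> A) v c e)
  hurwitz_scalerAl hurwitz_scalerAr.

Definition bar (P : A -> A) (a : hurwitz) : hurwitz :=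
  trunc (fun n => if n is m.+1 then coef a m else P (coef a 0)).

Definition tilde (P : A -> A) (a : idx l -> A) : idx l -> A :=
  trunc (fun n => P (coef a 0) + lambda *: \sum_(i < n) coef a i).

(* The terms with m > n of the sum over m vanish, since 'C(n, m) = 0. *)
Definition gamma (a : hurwitz) : idx l -> A :=
  trunc (fun n => \sum_(m < n.+1) (lambda ^+ m *: coef a m) *+ 'C(n, m)).

End Hurwitz.

Arguments bar {k A} lambda l P a.
Arguments tilde {k A} lambda l P a.
Arguments gamma {k A} lambda l a.

(* Q lifts P along the projection a |-> a_0, defined as soon as l > 0. *)
Definition lifts (A : Type) (l : option nat) (P : A -> A)
    (Q : (idx l -> A) -> (idx l -> A)) : Prop :=
  forall (a : idx l -> A) (i : idx l), val i = 0%N -> Q a i = P (a i).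

(* Main.v *)
Require Import Defs.
From HB Require Import structures.
From mathcomp Require Import all_boot all_algebra.
From mathcomp Require Import boolp functions.

Import GRing.Theory.
Local Open Scope ring_scope.

(** The shift [f |-> f (_ + 1)] is a derivation of weight [lambda] for the
    Hurwitz product ([hmulS]), and Pascal's rule gives
    [gamma f (n + 1) = gamma f n + lambda *: gamma (shift f) n].  Since the
    shift of [bar P f] is [f], while [tilde P f] has increments [lambda *: f n],
    each identity follows by induction on the index [n]. *)

(** * Identities for sequences indexed by all natural numbers *)

Section NatSequences.
Set Implicit Arguments.
Unset Strict Implicit.
Variables (k : comPzRingType) (A : pzAlgType k) (lambda : k).
Implicit Types (f g : nat -> A) (P : A -> A).

(** This and the next two definitions are untruncated forms of [bar], [tilde] and [gamma], so that
    inductions on the index carry no bound by [l]. *)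
Definition bar_seq P f (n : nat) : A := if n is m.+1 then f m else P (f 0%N).

Definition tilde_seq P f (n : nat) : A :=
  P (f 0%N) + lambda *: \sum_(i < n) f i.

Definition gamma_seq f (n : nat) : A :=
  \sum_(m < n.+1) (lambda ^+ m *: f m) *+ 'C(n, m).

(** Stated with the induced scaling [*:], convertible to [pzscale], for use by [rewrite]. *)
Lemma pzscaleAl (c : k) (x y : A) : c *: (x * y) = (c *: x) * y.
Proof. exact: pzscalerAl. Qed.

Lemma pzscaleAr (c : k) (x y : A) : c *: (x * y) = x * (c *: y).
Proof. exact: pzscalerAr. Qed.

(** Dependence on the entries up to [n] only is what later allows truncated sequences to be
    exchanged for untruncated ones. *)
Lemma eq_gamma_seq f g n : (forall i, (i <= n)%N -> f i = g i) ->
  gamma_seq f n = gamma_seq g n.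
Proof. by move=> fg; apply: eq_bigr => m _; rewrite fg// -ltnS. Qed.

Lemma eq_tilde_seq P f g n : (forall i, (i <= n)%N -> f i = g i) ->
  tilde_seq P f n = tilde_seq P g n.
Proof.
move=> fg; rewrite /tilde_seq fg//; congr (_ + _ *: _).
by apply: eq_bigr => i _; rewrite fg// ltnW.
Qed.

Lemma gamma_seq0 f : gamma_seq f 0 = f 0%N.
Proof. by rewrite /gamma_seq big_ord1 expr0 scale1r. Qed.

Lemma gamma_seqS f n :
  gamma_seq f n.+1 = gamma_seq f n + lambda *: gamma_seq (f \o succn) n.
Proof.
rewrite /gamma_seq big_ord_recl /=.
under eq_bigr do rewrite /bump leq0n add1n binS mulrnDr.
rewrite big_split /= addrA; congr (_ + _).
  (* The last term vanishes since ['C(n, n.+1)] is 0; the others, with the term [m = 0], form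
     [gamma_seq f n]. *)
  rewrite big_ord_recr /= (bin_small (ltnSn n)) mulr0n addr0.
  by rewrite [RHS]big_ord_recl !bin0.
rewrite scaler_sumr; apply: eq_bigr => m _.
by rewrite !scalerMnr scalerA -exprS.
Qed.

Lemma gamma_seqD f g n :
  gamma_seq (fun i => f i + g i) n = gamma_seq f n + gamma_seq g n.
Proof.
rewrite /gamma_seq -big_split; apply: eq_bigr => m _ /=.
by rewrite scalerDr mulrnDl.
Qed.

Lemma gamma_seqZ (c : k) f n :
  gamma_seq (fun i => c *: f i) n = c *: gamma_seq f n.
Proof.
rewrite /gamma_seq scaler_sumr; apply: eq_bigr => m _.
by rewrite !scalerMnr !scalerA mulrC.
Qed.

Lemma gamma_seq_one n : gamma_seq (hone A) n = 1.
Proof.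
rewrite /gamma_seq big_ord_recl big1 ?addr0 => [|i _].
  by rewrite expr0 scale1r bin0.
by rewrite /hone /= scaler0 mul0rn.
Qed.

(** Let [F], [G] be the images of [f], [g], and [F'], [G'] those of their shifts. From [n] to [n.+1]
    both sides grow by [lambda *: (F' * G + F * G' + lambda *: (F' * G'))]. The induction hypothesis
    is applied to shifts too, hence the generalization over [f] and [g]. *)
Lemma gamma_seqM f g n :
  gamma_seq (hmul lambda f g) n = gamma_seq f n * gamma_seq g n.
Proof.
elim: n f g => [|n IH] f g; first by rewrite !gamma_seq0 hmul0n.
rewrite !gamma_seqS IH (eq_gamma_seq (fun i _ => hmulS lambda f g i)).
rewrite !gamma_seqD gamma_seqZ !IH mulrDl !mulrDr !scalerDr.
rewrite -!pzscaleAl -!pzscaleAr.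
by rewrite [LHS](AC (1*3) (1*3*2*4)) !addrA.
Qed.

Lemma gamma_bar_seq P f n :
  gamma_seq (bar_seq P f) n = tilde_seq P (gamma_seq f) n.
Proof.
elim: n => [|n IH]; rewrite /tilde_seq.
  by rewrite big_ord0 scaler0 addr0 !gamma_seq0.
(* [bar_seq P f \o succn] is convertible to [f]. *)
by rewrite gamma_seqS IH big_ord_recr /= scalerDr addrA.
Qed.

Lemma tilde_seqS P f n : tilde_seq P f n.+1 = tilde_seq P f n + lambda *: f n.
Proof. by rewrite /tilde_seq big_ord_recr /= scalerDr addrA. Qed.

Lemma bar_seq_linear P (c : k) f g n : linear P ->
  bar_seq P (fun i => c *: f i + g i) n = c *: bar_seq P f n + bar_seq P g n.
Proof. by move=> linP; case: n => [|n] /=; [exact: linP | ]. Qed.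

Lemma tilde_seq_linear P (c : k) f g n : linear P ->
  tilde_seq P (fun i => c *: f i + g i) n
  = c *: tilde_seq P f n + tilde_seq P g n.
Proof.
move=> linP; elim: n => [|n IH].
  by rewrite /tilde_seq !big_ord0 !scaler0 !addr0 linP.
by rewrite !tilde_seqS IH !scalerDr !scalerA mulrC addrACA.
Qed.

(** At index 0 this is the identity for [P]; at a positive index it is the Leibniz rule [hmulS], as
    the shift undoes [bar_seq]. *)
Lemma bar_seqM P f g n : rota_baxter lambda P ->
  hmul lambda (bar_seq P f) (bar_seq P g) n
  = bar_seq P (fun i => hmul lambda (bar_seq P f) g i
      + hmul lambda f (bar_seq P g) i + lambda *: hmul lambda f g i) n.
Proof.
move=> [_ RB]; case: n => [|n]; first by rewrite /bar_seq !hmul0n RB.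
by rewrite hmulS /= [X in X + _ = _]addrC.
Qed.

(** The two sides agree at 0 by the identity for [P], and [tilde_seqS] gives them equal
    increments. *)
Lemma tilde_seqM P f g n : rota_baxter lambda P ->
  tilde_seq P f n * tilde_seq P g n
  = tilde_seq P (fun i => tilde_seq P f i * g i
      + f i * tilde_seq P g i + lambda *: (f i * g i)) n.
Proof.
move=> [_ RB]; elim: n => [|n IH].
  by rewrite /tilde_seq !big_ord0 !scaler0 !addr0 RB.
rewrite !tilde_seqS -IH mulrDl !mulrDr !scalerDr.
by rewrite -!pzscaleAl -!pzscaleAr !addrA.
Qed.

End NatSequences.

(** * Transfer to sequences indexed below [l] *)

Section Coef.
Set Implicit Arguments.
Unset Strict Implicit.
Variables (k : comPzRingType) (A : pzAlgType k) (lambda : k) (l : option nat).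
Implicit Types a b : idx l -> A.

Lemma coef_linear (c : k) a b :
  coef (c *: a + b) = fun n => c *: coef a n + coef b n.
Proof.
apply/funext => n; rewrite /coef; case: insubP => // _.
by rewrite scaler0 addr0.
Qed.

Lemma coefD a b n : coef (a + b) n = coef a n + coef b n.
Proof. by rewrite /coef; case: insubP => // _; rewrite addr0. Qed.

Lemma coefZ (c : k) a n : coef (c *: a) n = c *: coef a n.
Proof. by rewrite /coef; case: insubP => // _; rewrite scaler0. Qed.

Lemma coefM a b n : coef (a * b) n = coef a n * coef b n.
Proof. by rewrite /coef; case: insubP => // _; rewrite mulr0. Qed.

(** Indices up to a valid one are valid, so the default value 0 of [coef] does not occur there. *)
Lemma coef_trunc_le (f : nat -> A) (i : idx l) n :
  (n <= val i)%N -> coef (trunc f : idx l -> A) n = f n.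
Proof. by move=> ni; apply: coef_trunc; exact: below_le ni (valP i). Qed.

Lemma rota_baxter_bar (P : A -> A) :
  rota_baxter lambda P -> rota_baxter lambda (bar lambda l P).
Proof.
move=> RB; split=> [c a b|a b]; apply/funext => i.
  rewrite [LHS](congr1 (fun u => bar_seq P u (val i))
    (coef_linear c a b)).
  by rewrite bar_seq_linear//; case: RB.
have barE u j : (j <= val i)%N ->
    coef (bar lambda l P u) j = bar_seq P (coef u) j by exact: coef_trunc_le.
transitivity (hmul lambda (bar_seq P (coef a)) (bar_seq P (coef b)) (val i)).
  by apply: hmul_eq => j ji; apply: barE.
rewrite bar_seqM// -[RHS]coef_below barE//.
have cE j : (j <= val i)%N ->
    coef (bar lambda l P a * b + a * bar lambda l P b + lambda *: (a * b)) j
    = hmul lambda (bar_seq P (coef a)) (coef b) j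
      + hmul lambda (coef a) (bar_seq P (coef b)) j
      + lambda *: hmul lambda (coef a) (coef b) j.
  move=> ji; rewrite !coefD coefZ !(@coef_trunc_le _ i)//.
  by congr (_ + _ + _); apply: hmul_eq => // m mj; apply/barE/(leq_trans mj).
(* At index [n.+1] the outer [bar_seq] reads its argument at [n], and at 0 it reads it at 0; [cE]
   covers both. *)
by case: (val i) cE => [|n] cE /=; rewrite cE.
Qed.

Lemma rota_baxter_tilde (P : A -> A) :
  rota_baxter lambda P -> rota_baxter lambda (tilde lambda l P).
Proof.
move=> RB; split=> [c a b|a b]; apply/funext => i.
  rewrite [LHS](congr1 (fun u => tilde_seq lambda P u (val i))
    (coef_linear c a b)).
  by rewrite tilde_seq_linear//; case: RB.
rewrite [LHS](tilde_seqM (coef a) (coef b) (val i) RB).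
apply: eq_tilde_seq => j ji.
by rewrite !coefD coefZ !coefM !(@coef_trunc_le _ i).
Qed.

Lemma lifts_bar (P : A -> A) : lifts P (bar lambda l P).
Proof. by move=> a i i0; rewrite /bar /trunc i0 -i0 coef_below. Qed.

Lemma lifts_tilde (P : A -> A) : lifts P (tilde lambda l P).
Proof.
move=> a i i0; rewrite /tilde /trunc i0 big_ord0 scaler0 addr0.
by rewrite -i0 coef_below.
Qed.

Lemma gamma_bar (P : A -> A) (a : hurwitz A lambda l) :
  gamma lambda l (bar lambda l P a) = tilde lambda l P (gamma lambda l a).
Proof.
apply/funext => i.
transitivity (gamma_seq lambda (bar_seq P (coef a)) (val i)).
  by apply: eq_gamma_seq => j ji; exact: coef_trunc_le ji.
rewrite gamma_bar_seq; apply: eq_tilde_seq => j ji.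
by rewrite (@coef_trunc_le _ i).
Qed.

Lemma gamma_morphism :
  algebra_morphism (gamma lambda l : hurwitz A lambda l -> (idx l -> A)).
Proof.
split=> [c a b|]; first apply/funext => i.
  rewrite [LHS](congr1 (fun u => gamma_seq lambda u (val i))
    (coef_linear c a b)).
  by rewrite gamma_seqD gamma_seqZ.
split=> [|a b]; apply/funext => i.
  rewrite -[RHS](gamma_seq_one A lambda (val i)).
  by apply: eq_gamma_seq => j ji; exact: coef_trunc_le ji.
rewrite -[RHS](gamma_seqM lambda (coef a) (coef b) (val i)).
by apply: eq_gamma_seq => j ji; exact: coef_trunc_le ji.
Qed.

End Coef.

Theorem proposition3p3 (k : comPzAlgType rat) (lambda : k) (A : pzAlgType k)
    (l : option nat) :
  (forall P : A -> A, rota_baxter lambda P ->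
    [/\ rota_baxter lambda (bar lambda l P) /\ lifts P (bar lambda l P),
        rota_baxter lambda (tilde lambda l P) /\ lifts P (tilde lambda l P)
      & forall a : hurwitz A lambda l,
          gamma lambda l (bar lambda l P a)
          = tilde lambda l P (gamma lambda l a)])
  /\ algebra_morphism (gamma lambda l : hurwitz A lambda l -> (idx l -> A)).
Proof.
split=> [P RB|]; last exact: gamma_morphism.
split; last exact: gamma_bar.
- by split; [exact: rota_baxter_bar | exact: lifts_bar].
- by split; [exact: rota_baxter_tilde | exact: lifts_tilde].
Qed.
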